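(* Let $X\subseteq\mathbb{R}^n$ be nonempty, closed, convex and bounded, and let $F:X\to\mathbb{R}^n$ be monotone on $X$ (i.e. $\langle F(x)-F(y),x-y\rangle\ge 0$ for all $x,y\in X$) and satisfy, for some $\nu\in(0,1)$ and $L_\nu>0$, $\|F(x)-F(y)\|_*\le L_\nu\|x-y\|^\nu$ for all $x,y\in X$. Let $D>0$ satisfy $\max_{x,z\in X}B_\psi(z,x)\le D$, let $c>0$, $0<a<1$, and set $$\widehat C=(1-\nu)\left[\left(\frac{2^{1+2\nu}L_\nu^2\nu^\nu}{\alpha^{1+\nu}}\right)^{\frac1{1-\nu}}+\left(\frac{2^{1+\nu}L_\nu^2\nu^\nu}{\alpha^{1+\nu}}\right)^{\frac1{1-\nu}}\right].$$ Then for the iterates of the deterministic Popov mirror-prox algorithm: (i) With known number $T\ge0$ of iterations and constant step size $\gamma_t=\frac{c}{(T+1)^a}$, $$G\left(\frac1{T+1}\sum_{t=0}^Ty_{t+1}\right)\le\frac{D}{c(T+1)^{1-a}}+\frac{\widehat C\,c^{\frac{1+\nu}{1-\nu}}}{(T+1)^{\frac{a(1+\nu)}{1-\nu}}}.$$ (ii) With step size $\gamma_t=\frac{c}{(t+1)^a}$, for any $T\ge0$, $$G\left(\frac{\sum_{t=0}^T\gamma_ty_{t+1}}{\sum_{t=0}^T\gamma_t}\right)\le\begin{cases}\dfrac{D}{c(T+1)^{1-a}}+\dfrac{\widehat C(1-\nu)c^{\frac{1+\nu}{1-\nu}}}{(1-\nu-2a)(T+1)^{\frac{a(1+\nu)}{1-\nu}}}&\text{for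 }0<a<\frac{1-\nu}2,\\[2mm]\dfrac{D}{c(T+1)^{1-a}}+\dfrac{\widehat C\,c^{\frac{1+\nu}{1-\nu}}(1+\ln(T+1))}{(T+1)^{1-a}}&\text{for }a=\frac{1-\nu}2,\\[2mm]\dfrac{D}{c(T+1)^{1-a}}+\dfrac{2a\widehat C\,c^{\frac{1+\nu}{1-\nu}}}{(2a+\nu-1)(T+1)^{1-a}}&\text{for }\frac{1-\nu}2<a<1.\end{cases}$$ (iii) With step size $\gamma_t=\frac{c}{(t+1)^a}$, for any $T\ge1$, $$G\left(\frac{\sum_{t=0}^T\gamma_t^{-1}y_{t+1}}{\sum_{t=0}^T\gamma_t^{-1}}\right)\le\frac{4^a(1+a)D}{cT^{1-a}}+E_T,$$ where $$E_T=\begin{cases}\dfrac{2^{\frac{1-\nu-2\nu a}{1-\nu}}c^{\frac{1+\nu}{1-\nu}}(1+a)(1-\nu)^2\left(2^{\frac{\nu}{1-\nu}}+1\right)\left(\frac{2^{1+\nu}L_\nu^2\nu^\nu}{\alpha^{1+\nu}}\right)^{\frac1{1-\nu}}}{(1-\nu-2\nu a)\,T^{\frac{a(1+\nu)}{1-\nu}}}&\text{for }0<a<\frac{1-\nu}{2\nu},\\[4mm]\dfrac{c^{\frac{1+\nu}{1-\nu}}(1+a)(1-\nu)\left(2^{\frac{\nu}{1-\nu}}+1\right)\left(\frac{2^{1+\nu}L_\nu^2\nu^\nu}{\alpha^{1+\nu}}\right)^{\frac1{1-\nu}}(1+\ln(T+1))}{T^{1+a}}&\text{for }a=\frac{1-\nu}{2\nu},\\[4mm]\dfrac{2a\nu\,c^{\frac{1+\nu}{1-\nu}}(1+a)(1-\nu)\left(2^{\frac{\nu}{1-\nu}}+1\right)\left(\frac{2^{1+\nu}L_\nu^2\nu^\nu}{\alpha^{1+\nu}}\right)^{\frac1{1-\nu}}}{(2\nu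 a+\nu-1)\,T^{1+a}}&\text{for }\frac{1-\nu}{2\nu}<a<1.\end{cases}$$
   Context: $\|\cdot\|$ is an arbitrary norm on $\mathbb{R}^n$, $\langle\cdot,\cdot\rangle$ the standard inner product, and $\|x\|_*=\max_{\|z\|\le1}\langle x,z\rangle$ the conjugate norm. The function $\psi:X\to\mathbb{R}$ is continuously differentiable and $\alpha$-strongly convex for some $\alpha>0$: $\psi(z)\ge\psi(x)+\langle\nabla\psi(x),z-x\rangle+\frac{\alpha}{2}\|z-x\|^2$ for all $x,z\in X$. Its Bregman divergence is $B_\psi(z,x)=\psi(z)-\psi(x)-\langle\nabla\psi(x),z-x\rangle$, $x,z\in X$. Deterministic Popov mirror-prox algorithm: $x_0=y_0\in X$ arbitrary, and for $t\ge0$ with step size $\gamma_t>0$, $$y_{t+1}=\operatorname*{argmin}_{z\in X}\left[\langle\gamma_tF(y_t)-\nabla\psi(x_t),z\rangle+\psi(z)\right],\qquad x_{t+1}=\operatorname*{argmin}_{z\in X}\left[\langle\gamma_tF(y_{t+1})-\nabla\psi(x_t),z\rangle+\psi(z)\right].$$ Dual gap function: $G(x)=\sup_{z\in X}\langle F(z),x-z\rangle$ for $x\in X$. *)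

(* Defs.v *)
From HB Require Import structures.
From mathcomp Require Import all_boot all_order all_algebra.
From mathcomp Require Import all_classical all_reals all_analysis.
Import Order.TTheory GRing.Theory Num.Theory.
Import numFieldNormedType.Exports.

Set Implicit Arguments.
Unset Strict Implicit.
Unset Printing Implicit Defensive.

Local Open Scope classical_set_scope.
Local Open Scope ring_scope.

Definition inner (R : realType) (n : nat) (u v : 'rV[R]_n) : R :=
  \sum_(i < n) u 0 i * v 0 i.

(* An arbitrary norm on R^n. It is kept apart from the library norm `|x| on
   'rV[R]_n, which is the sup norm; the latter only serves below for topological
   notions, which do not depend on the norm in finite dimension. *)
Record is_norm (R : realType) (n : nat) (N : 'rV[R]_n -> R) : Prop := IsNorm {
  is_norm_triangle : forall x y, N (x + y) <= N x + N y ;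
  is_norm_scale : forall (a : R) x, N (a *: x) = `|a| * N x ;
  is_norm_eq0 : forall x, N x = 0 -> x = 0 }.

(* The supremum is taken in \bar R, so that no attainment or boundedness proof
   is built into the definition; it is finite and attained as N is a norm. *)
Definition dual_norm (R : realType) (n : nat) (N : 'rV[R]_n -> R)
    (x : 'rV[R]_n) : \bar R :=
  ereal_sup [set (inner x z)%:E | z in [set z | N z <= 1]].

(* psi is continuously differentiable on X with gradient dpsi. Differentiability
   at x is relative to X (the limit is over z in X), since psi is a function on X
   and X may have boundary points or even an empty interior. A function that is
   C^1 on an open neighbourhood of X satisfies this with its usual gradient. *)
Definition C1_on (R : realType) (n : nat) (X : set 'rV[R]_n)
    (psi : 'rV[R]_n -> R) (dpsi : 'rV[R]_n -> 'rV[R]_n) : Prop :=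
  (forall x, X x -> forall e : R, 0 < e ->
     \forall z \near within X (nbhs x),
       `|psi z - psi x - inner (dpsi x) (z - x)| <= e * `|z - x|) /\
  {within X, continuous dpsi}.

Definition strongly_convex_on (R : realType) (n : nat) (N : 'rV[R]_n -> R)
    (X : set 'rV[R]_n) (alpha : R)
    (psi : 'rV[R]_n -> R) (dpsi : 'rV[R]_n -> 'rV[R]_n) : Prop :=
  forall x z, X x -> X z ->
    psi z >= psi x + inner (dpsi x) (z - x) + alpha / 2 * N (z - x) ^+ 2.

Definition bregman (R : realType) (n : nat)
    (psi : 'rV[R]_n -> R) (dpsi : 'rV[R]_n -> 'rV[R]_n) (z x : 'rV[R]_n) : R :=
  psi z - psi x - inner (dpsi x) (z - x).

Definition monotone_on (R : realType) (n : nat) (X : set 'rV[R]_n)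
    (F : 'rV[R]_n -> 'rV[R]_n) : Prop :=
  forall x y, X x -> X y -> inner (F x - F y) (x - y) >= 0.

Definition holder_on (R : realType) (n : nat) (N : 'rV[R]_n -> R)
    (X : set 'rV[R]_n) (nu L : R) (F : 'rV[R]_n -> 'rV[R]_n) : Prop :=
  forall x y, X x -> X y ->
    (dual_norm N (F x - F y) <= (L * N (x - y) `^ nu)%:E)%E.

Definition dual_gap (R : realType) (n : nat) (X : set 'rV[R]_n)
    (F : 'rV[R]_n -> 'rV[R]_n) (x : 'rV[R]_n) : \bar R :=
  ereal_sup [set (inner (F z) (x - z))%:E | z in X].

Definition is_argmin (R : realType) (n : nat) (X : set 'rV[R]_n)
    (f : 'rV[R]_n -> R) (p : 'rV[R]_n) : Prop :=
  X p /\ forall z, X z -> f p <= f z.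

Definition popov_iterates (R : realType) (n : nat) (X : set 'rV[R]_n)
    (F : 'rV[R]_n -> 'rV[R]_n)
    (psi : 'rV[R]_n -> R) (dpsi : 'rV[R]_n -> 'rV[R]_n)
    (gamma : nat -> R) (x y : nat -> 'rV[R]_n) : Prop :=
  [/\ X (x 0%N), y 0%N = x 0%N &
      forall t : nat,
        is_argmin X (fun z => inner (gamma t *: F (y t) - dpsi (x t)) z + psi z)
          (y t.+1) /\
        is_argmin X
          (fun z => inner (gamma t *: F (y t.+1) - dpsi (x t)) z + psi z)
          (x t.+1)].

Definition step (R : realType) (c a : R) (t : nat) : R := c / t.+1%:R `^ a.

Definition holder_const (R : realType) (nu L alpha e : R) : R :=
  (2 `^ e * L ^+ 2 * nu `^ nu / alpha `^ (1 + nu)) `^ (1 / (1 - nu)).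

Definition Chat (R : realType) (nu L alpha : R) : R :=
  (1 - nu) * (holder_const nu L alpha (1 + 2 * nu)
              + holder_const nu L alpha (1 + nu)).

(* Main.v *)
(* One step of the method satisfies, by the optimality conditions of the two
   argmins, strong convexity and the Hoelder bound,
     g <F y1, y1 - z> <= B(z, x0) - B(z, x1) - alpha/2 p^2 - alpha/2 r^2
                         + g L (p + q)^nu r,
   with p = |y1 - x0|, q = |x0 - y0|, r = |x1 - y1|. Young's inequality gives up
   half of the r^2 term and bounds the cross term by
   2 g^2 L^2 / alpha (p^(2 nu) + q^(2 nu)) + alpha/4 r^2. The p term is absorbed
   by -alpha/2 p^2; the q term is absorbed by the other half of the r^2 term of
   the previous step, since q there is the previous r. Each absorption costs a
   multiple of g^(2/(1-nu)), and the two constants add up to Chat. Multiplying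
   by weights w_t with w_t nondecreasing and w_t gamma_t^2 nonincreasing keeps the
   telescoping valid; w = 1/gamma, 1 and gamma^-2 give (i), (ii) and (iii), where
   the remaining power sums are compared with integrals. *)
Require Import Defs.
From HB Require Import structures.
From mathcomp Require Import all_boot all_order all_algebra.
From mathcomp Require Import all_classical all_reals all_analysis.
From mathcomp Require Import ring lra.
Import Order.TTheory GRing.Theory Num.Theory.
Import numFieldNormedType.Exports.
Local Open Scope classical_set_scope.
Local Open Scope ring_scope.

Set Implicit Arguments.
Unset Strict Implicit.

(** * Powers and power sums *)

Lemma powRD_gt0 {R : realType} (x r s : R) :
  0 < x -> x `^ (r + s) = x `^ r * x `^ s.
Proof. by move=> x0; apply: powRD; rewrite (gt_eqF x0) implybT. Qed.

(** Weighted AM-GM, obtained from Young's inequality for [x ^ b] and [y ^ (1 - b)] with conjugate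
    exponents [1 / b] and [1 / (1 - b)]. Besides the absorption estimates, it supplies the one-step
    increments of the power sums below, in place of integrals. *)
Lemma powR_amgm {R : realType} (b x y : R) : 0 < b < 1 -> 0 <= x -> 0 <= y ->
  x `^ b * y `^ (1 - b) <= b * x + (1 - b) * y.
Proof.
move=> /andP[b0 b1] x0 y0.
have b'0 : 0 < 1 - b by rewrite subr_gt0.
have := @conjugate_powR R (x `^ b) (y `^ (1 - b)) b^-1 (1 - b)^-1
  (powR_ge0 _ _) (powR_ge0 _ _).
rewrite !invr_gt0 !invrK => /(_ b0 b'0); rewrite -!powRrM !divff ?gt_eqF//.
rewrite !powRr1// addrC subrK => /(_ erefl).
by rewrite (mulrC x) (mulrC y).
Qed.

(** AM-GM with weight [nu] at [beta * s / nu] and [(K * nu ^ nu / beta ^ nu) ^ (1 / (1 - nu))]. The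
    first point makes the linear term exactly [beta * s]; the second makes the product exactly
    [K * s ^ nu]. *)
Lemma powR_young {R : realType} (nu K beta s : R) : 0 < nu < 1 -> 0 <= K ->
  0 < beta -> 0 <= s ->
  K * s `^ nu <=
    beta * s + (1 - nu) * (K * nu `^ nu / beta `^ nu) `^ (1 / (1 - nu)).
Proof.
move=> nu01 K0 beta0 s0; have /andP[nu0 nu1] := nu01.
have nuN : 1 - nu != 0 by rewrite subr_eq0 gt_eqF.
have bs0 : 0 <= beta * s / nu by rewrite divr_ge0 ?mulr_ge0 ?(ltW beta0) ?(ltW nu0).
have := powR_amgm nu01 bs0 (powR_ge0 (K * nu `^ nu / beta `^ nu) (1 / (1 - nu))).
rewrite -[in X in X <= _]powRrM divfK// powRr1; last first.
  by rewrite divr_ge0 ?mulr_ge0 ?powR_ge0.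
have -> : (beta * s / nu) `^ nu = beta `^ nu * s `^ nu * (nu `^ nu)^-1.
  rewrite -(powR_inv1 (ltW nu0)) powRM ?powR_ge0 ?mulr_ge0 ?(ltW beta0)//.
  by rewrite powRM ?(ltW beta0)// -powRrM mulN1r powRN.
have := powR_gt0 nu nu0; have := powR_gt0 nu beta0.
set A := beta `^ nu; set B := nu `^ nu => A0 B0.
have -> : A * s `^ nu * B^-1 * (K * B / A) = K * s `^ nu.
  by field; rewrite !gt_eqF.
by have -> : nu * (beta * s * nu^-1) = beta * s by field; rewrite gt_eqF.
Qed.

Lemma sum_powR_ge {R : realType} (a : R) (m : nat) : 0 < a ->
  m%:R `^ (1 + a) / (1 + a) <= \sum_(0 <= t < m) t.+1%:R `^ a.
Proof.
move=> a0; have a1 : 0 < 1 + a by lra.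
elim: m => [|m IH]; first by rewrite big_geq// powR0 ?gt_eqF// mul0r.
rewrite big_nat_recr//=; apply: le_trans (lerD IH (lexx _)).
have m0 : 0 < m.+1%:R :> R by rewrite ltr0n.
have b01 : 0 < (1 + a)^-1 < 1.
  by rewrite invr_gt0 a1 invf_lt1// ltrDl.
(* With weight [1 / (1 + a)] the left side is [m * (m + 1) ^ a]. This is the tangent inequality for
   the convex power [1 + a] at [m + 1], which bounds the increment. *)
have := powR_amgm b01 (powR_ge0 (m%:R : R) (1 + a)) (powR_ge0 m.+1%:R (1 + a)).
rewrite -!powRrM divff ?gt_eqF//.
have -> : (1 + a) * (1 - (1 + a)^-1) = a by field; rewrite gt_eqF.
rewrite powRr1// [in m.+1%:R `^ (1 + a)]powRD_gt0// powRr1 ?(ltW m0)//.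
rewrite -(natr1 m) in m0 *.
set i := (1 + a)^-1; set A := _ `^ a; set B := _ `^ (1 + a) => h.

by nra.
Qed.

Lemma sum_powRN_le_lt1 {R : realType} (b : R) (m : nat) : 0 < b < 1 ->
  \sum_(0 <= t < m) t.+1%:R `^ (- b) <= m%:R `^ (1 - b) / (1 - b).
Proof.
move=> /andP[b0 b1]; have b'0 : 0 < 1 - b by lra.
elim: m => [|m IH]; first by rewrite big_geq// powR0 ?gt_eqF// mul0r.
rewrite big_nat_recr//=; apply: le_trans (lerD IH (lexx _)) _.
have m0 : 0 < m.+1%:R :> R by rewrite ltr0n.
have b01 : 0 < 1 - b < 1 by lra.
(* This is [m ^ (1 - b) * (m + 1) ^ b <= m + b], the increment bound multiplied by
   [(1 - b) * (m + 1) ^ b] and rearranged. *)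
have := powR_amgm b01 (ler0n R m) (ltW m0).
rewrite (_ : 1 - (1 - b) = b); last by ring.
rewrite powRN [in m.+1%:R `^ (1 - b)]powRD_gt0// powRr1 ?(ltW m0)// powRN.
have := powR_gt0 b m0; rewrite -(natr1 m).
set A := _ `^ b; set B := _ `^ (1 - b) => A0 h.
rewrite -(ler_pM2r (mulr_gt0 b'0 A0)).
rewrite [leLHS](_ : _ = B * A + (1 - b)); last by field; rewrite !gt_eqF.
rewrite [leRHS](_ : _ = m%:R + 1); last by field; rewrite !gt_eqF.
lra.
Qed.

Lemma sum_inv_le {R : realType} (m : nat) :
  \sum_(0 <= t < m.+1) (t.+1%:R : R)^-1 <= 1 + ln m.+1%:R.
Proof.
elim: m => [|m IH]; first by rewrite big_nat1 ln1 invr1 addr0.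
rewrite big_nat_recr//=; apply: le_trans (lerD IH (lexx _)) _.
rewrite -addrA lerD2l.
have m0 : 0 < m.+1%:R :> R by rewrite ltr0n.
have m1 : 0 < m.+2%:R :> R by rewrite ltr0n.
(* [ln (1 - u) <= - u] at [u = 1 / (m + 2)] bounds the new term by [ln (m + 2) - ln (m + 1)]. *)
have := @le_ln1Dx R (- m.+2%:R^-1).
rewrite ltrN2 invf_lt1// ltr1n => /(_ isT).
rewrite (_ : 1 - _ = m.+1%:R / m.+2%:R); last first.
  by rewrite -[m.+1%:R](addrK 1) natr1 mulrBl mul1r divff ?gt_eqF.
rewrite ln_div ?posrE//.
by move: (ln m.+1%:R) (ln m.+2%:R) (m.+2%:R^-1) => u v w; lra.
Qed.

Lemma sum_powRN_le_gt1 {R : realType} (b : R) (m : nat) : 1 < b ->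
  \sum_(0 <= t < m) t.+1%:R `^ (- b) <= b / (b - 1).
Proof.
move=> b1; have b0 : 0 < b by lra.
have b'0 : 0 < b - 1 by lra.
case: m => [|m]; first by rewrite big_geq// divr_ge0 ?(ltW b0) ?(ltW b'0).
(* The constant bound alone is not inductive; the tail [m.+1 ^ (1 - b) / (b - 1)] is subtracted so
   that each new term is paid for by the decrease of the tail. *)
suff: \sum_(0 <= t < m.+1) t.+1%:R `^ (- b) <=
    b / (b - 1) - m.+1%:R `^ (1 - b) / (b - 1).
  by move=> /le_trans; apply; rewrite gerBl divr_ge0 ?powR_ge0 ?(ltW b'0).
elim: m => [|m IH].
  by rewrite big_nat1 !powR1 -mulrBl divff ?gt_eqF.
rewrite big_nat_recr//=; apply: le_trans (lerD IH (lexx _)) _.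
have m0 : 0 < m.+1%:R :> R by rewrite ltr0n.
have m1 : 0 < m.+2%:R :> R by rewrite ltr0n.
have b01 : 0 < b^-1 < 1 by rewrite invr_gt0 b0 invf_lt1.
(* The arguments are chosen so that the powers of [m.+1] cancel in the product and only [m.+2]
   remains on the left. *)
have := powR_amgm b01
  (mulr_ge0 (powR_ge0 m.+1%:R (1 - b)) (powR_ge0 m.+2%:R b)) (ltW m0).
rewrite powRM ?powR_ge0// -!powRrM divff ?gt_eqF// powRr1 ?(ltW m1)//.
rewrite mulrAC -powRD_gt0// (_ : _ + _ = 0); last by field; rewrite gt_eqF.
rewrite powRr0 mul1r powRN [in m.+2%:R `^ (1 - b)]powRD_gt0// powRr1 ?(ltW m1)// powRN.
have := powR_gt0 b m1; rewrite -(natr1 m.+1).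
set A := _ `^ b; set B := _ `^ (1 - b); set x := m.+1%:R => A0.
rewrite -(ler_pM2l b0) [leRHS](_ : _ = B * A + (b - 1) * x); last first.
  by field; rewrite gt_eqF.
move=> h; rewrite -(ler_pM2r (mulr_gt0 b'0 A0)).
rewrite [leLHS](_ : _ = b * A - B * A + (b - 1)); last by field; rewrite !gt_eqF.
rewrite [leRHS](_ : _ = b * A - (x + 1)); last by field; rewrite !gt_eqF.
lra.
Qed.

(** Each of [u = x] and [u = y] is at most [x + y], so [u <= u ^ nu * (x + y) ^ (1 - nu)]. Adding
    the two and cancelling the positive factor [(x + y) ^ (1 - nu)] gives the claim. *)
Lemma powR_subadd {R : realType} (nu x y : R) : 0 < nu < 1 ->
  0 <= x -> 0 <= y -> (x + y) `^ nu <= x `^ nu + y `^ nu.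
Proof.
move=> /andP[nu0 nu1] x0 y0.
have [xy0|xyN0] := eqVneq (x + y) 0.
  by rewrite xy0 powR0 ?gt_eqF// addr_ge0 ?powR_ge0.
have xy0 : 0 < x + y by rewrite lt_def xyN0 addr_ge0.
have nu'0 : 0 <= 1 - nu by lra.
have split_le u : 0 <= u -> u <= x + y -> u <= u `^ nu * (x + y) `^ (1 - nu).
  move=> u0 uxy; have [->|uN0] := eqVneq u 0.
    by rewrite mulr_ge0 ?powR_ge0.
  have u_gt0 : 0 < u by rewrite lt_def uN0.
  rewrite -{1}[u](powRr1 (ltW u_gt0)) -{1}(subrKC nu 1) powRD_gt0//.
  by rewrite ler_wpM2l ?powR_ge0// ge0_ler_powR// nnegrE ltW.
rewrite -(ler_pM2r (powR_gt0 (1 - nu) xy0)) -powRD_gt0// subrKC powRr1 ?(ltW xy0)//.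
by rewrite mulrDl lerD// split_le// ?lerDl ?lerDr.
Qed.

Lemma powRV {R : realType} (x r : R) : 0 <= x -> x^-1 `^ r = (x `^ r)^-1.
Proof. by move=> x0; rewrite -powR_inv1// -powRrM mulN1r powRN. Qed.

(** Young's inequality with linear coefficient [alpha / 2 ^ k], whose power [nu] in the denominator
    produces the factor [2 ^ (k * nu)] of the constant. The cases [k = 1] and [k = 2] give the two
    summands of [Chat]. *)
Lemma holder_young {R : realType} (nu L alpha g s : R) (k : nat) :
  0 < nu < 1 -> 0 < alpha -> 0 <= g -> 0 <= s ->
  2 * L ^+ 2 / alpha * g ^+ 2 * s `^ nu <=
    alpha / 2 ^+ k * s +
    (1 - nu) * holder_const nu L alpha (1 + k%:R * nu) * g `^ (2 / (1 - nu)).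
Proof.
move=> nu01 alpha0 g0 s0; have /andP[nu0 nu1] := nu01.
have c0 : 0 < 2 ^+ k :> R by rewrite exprn_gt0.
have K0 : 0 <= 2 * L ^+ 2 / alpha * g ^+ 2.
  rewrite mulr_ge0 ?sqr_ge0 ?divr_ge0 ?(ltW alpha0) // mulr_ge0 ?sqr_ge0 ?ler0n //.
apply: le_trans (powR_young nu01 K0 (divr_gt0 alpha0 c0) s0) _.
rewrite lerD2l -[leRHS]mulrA ler_wpM2l ?subr_ge0 ?(ltW nu1)//.
rewrite /holder_const.
have -> : g `^ (2 / (1 - nu)) = (g ^+ 2) `^ (1 / (1 - nu)).
  by rewrite -powR_mulrn// -powRrM div1r.
rewrite -powRM ?sqr_ge0//; last first.
  by rewrite divr_ge0 ?powR_ge0// mulr_ge0 ?powR_ge0// mulr_ge0 ?powR_ge0 ?sqr_ge0.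
rewrite (_ : _ / (alpha / _) `^ nu = 2 `^ (1 + k%:R * nu) * L ^+ 2 * nu `^ nu /
  alpha `^ (1 + nu) * g ^+ 2)//.
rewrite !powRD_gt0// !powRr1 ?(ltW alpha0)// powRrM powR_mulrn//.
rewrite powRM ?invr_ge0 ?(ltW alpha0) ?(ltW c0)// powRV ?(ltW c0)//.
have := powR_gt0 nu alpha0; have := powR_gt0 nu c0.
set A := _ `^ nu; set B := alpha `^ nu => A0 B0.
by field; rewrite !gt_eqF.
Qed.

(** * Inner products, norms and optimality conditions *)

Section inner_product.
Context {R : realType} {n : nat}.
Implicit Types (u v w : 'rV[R]_n) (k : R).

Lemma innerDl u v w : inner (u + v) w = inner u w + inner v w.
Proof. by rewrite -big_split; apply: eq_bigr => i _; rewrite mxE mulrDl. Qed.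

Lemma innerC u v : inner u v = inner v u.
Proof. by apply: eq_bigr => i _; rewrite mulrC. Qed.

Lemma innerDr u v w : inner u (v + w) = inner u v + inner u w.
Proof. by rewrite !(innerC u) innerDl. Qed.

Lemma innerZl k u v : inner (k *: u) v = k * inner u v.
Proof. by rewrite /inner mulr_sumr; apply: eq_bigr => i _; rewrite mxE mulrA. Qed.

Lemma innerZr k u v : inner u (k *: v) = k * inner u v.
Proof. by rewrite !(innerC u) innerZl. Qed.

Lemma innerNl u v : inner (- u) v = - inner u v.
Proof. by rewrite -scaleN1r innerZl mulN1r. Qed.

Lemma innerNr u v : inner u (- v) = - inner u v.
Proof. by rewrite !(innerC u) innerNl. Qed.

Lemma inner0r u : inner u 0 = 0.
Proof. by rewrite -(scale0r 0) innerZr mul0r. Qed.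

Lemma inner_sumr u (I : Type) (r : seq I) (f : I -> 'rV[R]_n) :
  inner u (\sum_(i <- r) f i) = \sum_(i <- r) inner u (f i).
Proof. by apply: (big_morph (inner u)) => [v w|]; rewrite ?innerDr ?inner0r. Qed.

End inner_product.

Section norm.
Context {R : realType} {n : nat} (N : 'rV[R]_n -> R) (hN : is_norm N).

Lemma is_norm0 : N 0 = 0.
Proof. by rewrite -(scale0r 0) is_norm_scale// normr0 mul0r. Qed.

Lemma is_normN x : N (- x) = N x.
Proof. by rewrite -scaleN1r is_norm_scale// normrN1 mul1r. Qed.

Lemma is_norm_ge0 x : 0 <= N x.
Proof. by have := is_norm_triangle hN x (- x); rewrite subrr is_norm0 is_normN; lra. Qed.

Lemma dual_norm_cauchy_schwarz (u w : 'rV[R]_n) (M : R) :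
  (dual_norm N u <= M%:E)%E -> inner u w <= M * N w.
Proof.
move=> uM; have [/(is_norm_eq0 hN) ->|Nw0] := eqVneq (N w) 0.
  by rewrite inner0r is_norm0 mulr0.
have Nw_gt0 : 0 < N w by rewrite lt_def Nw0 is_norm_ge0.
rewrite -ler_pdivrMr// mulrC -innerZr -lee_fin; apply: le_trans uM.
apply: ereal_sup_ubound; exists ((N w)^-1 *: w) => //=.
by rewrite is_norm_scale// ger0_norm ?invr_ge0 ?is_norm_ge0// mulVf.
Qed.

End norm.

Section argmin.
Context {R : realType} {n : nat} (X : set 'rV[R]_n).
Variables (psi : 'rV[R]_n -> R) (dpsi : 'rV[R]_n -> 'rV[R]_n).
Hypothesis hXconvex : convex_set (X : set (convex_lmodType 'rV[R]_n)).

Lemma convex_set_segment (p z : 'rV[R]_n) (s : R) :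
  X p -> X z -> 0 <= s <= 1 -> X (p + s *: (z - p)).
Proof.
move=> Xp Xz /andP[s0 s1].
have := hXconvex (Itv01 s0 s1) (mem_set Xz) (mem_set Xp).
rewrite inE; congr (X _).
by rewrite /conv/= scalerBr scalerBl scale1r addrCA.
Qed.

Hypothesis hpsi : C1_on X psi dpsi.

(** A short move from [p] towards [z] stays in [X] and cannot decrease the objective. Its
    first-order change is the inner product times the step length [s], up to an error at most
    [s * e]; dividing by [s] leaves [e], which is arbitrary. *)
Lemma argmin_first_order (g p z : 'rV[R]_n) :
  is_argmin X (fun u => inner g u + psi u) p -> X z ->
  0 <= inner (g + dpsi p) (z - p).
Proof.
move=> [Xp pmin] Xz; apply/ler_addgt0Pr => /= e e0.
set M := `|z - p|.
have M0 : 0 < M + 1 := ltr_wpDl (normr_ge0 _) ltr01.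
have /nbhs_ballP[d /= d0 hd] := hpsi.1 p Xp (e / (M + 1)) (divr_gt0 e0 M0).
(* The bound [1] keeps the point on the segment, and the other bound puts it in the ball where the
   differentiability estimate holds. Using [M + 1] instead of [M] covers the case [z = p]. *)
pose s := Num.min 1 (d / (M + 1)).
have s0 : 0 < s by rewrite lt_min ltr01 divr_gt0.
have s1 : s <= 1 by rewrite ge_min lexx.
have sM : s * M < d.
  have : s <= d / (M + 1) by rewrite ge_min lexx orbT.
  rewrite ler_pdivlMr// => sd; apply: lt_le_trans sd.
  by rewrite ltr_pM2l// ltrDl.
set u := p + s *: (z - p).
have Xu : X u by apply: convex_set_segment; rewrite // ltW.
have up : u - p = s *: (z - p) by rewrite /u addrC addKr.
have := hd u; rewrite -ball_normE /= distrC up normrZ (gtr0_norm s0).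
move=> /(_ sM Xu) /(le_trans (ler_norm _)).
have h1 := pmin u Xu; have h4 : inner g u = s * inner g (z - p) + inner g p.
  by rewrite /u innerDr innerZr addrC.
rewrite -/M innerZr => h2.
have h3 : e / (M + 1) * (s * M) <= s * e.
  rewrite mulrCA ler_wpM2l ?(ltW s0)// -mulrA ler_piMr ?(ltW e0)//.
  by rewrite mulrC ler_pdivrMr// mul1r lerDl.
rewrite innerDl -(pmulr_rge0 _ s0); lra.
Qed.

End argmin.

(** * Weighted regret *)

Lemma popov_cross_term_le {R : realType} (nu L alpha g m p q r : R) :
  0 < nu < 1 -> 0 < alpha -> 0 <= L -> 0 <= g ->
  0 <= p -> 0 <= q -> 0 <= r -> 0 <= m <= p + q ->
  g * (L * m `^ nu * r) <=
    2 * L ^+ 2 / alpha * g ^+ 2 * (p ^+ 2) `^ nu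
    + 2 * L ^+ 2 / alpha * g ^+ 2 * (q ^+ 2) `^ nu + alpha / 4 * r ^+ 2.
Proof.
move=> nu01 alpha0 L0 g0 p0 q0 r0 /andP[m0 mpq].
have /andP[nu0 _] := nu01.
have sqr_powR u : 0 <= u -> (u ^+ 2) `^ nu = (u `^ nu) ^+ 2.
  by move=> u0; rewrite !expr2 powRM.
have mle : m `^ nu <= p `^ nu + q `^ nu.
  apply: le_trans (powR_subadd nu01 p0 q0).
  by rewrite ge0_ler_powR ?nnegrE ?addr_ge0 ?(ltW nu0).
rewrite !sqr_powR//; move: (p `^ nu) (q `^ nu) (m `^ nu) mle => P Q S mle.
apply: (@le_trans _ _ (g * L * (P + Q) * r)).
  by rewrite mulrA mulrA ler_wpM2r// ler_wpM2l// mulr_ge0.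
rewrite -(ler_pM2r alpha0).
(* After multiplication by [alpha], the difference of the two sides is the sum of the squares of
   [g L (P + Q) - alpha r / 2] and [g L (P - Q)]. *)
rewrite [leRHS](_ : _ = 2 * (g * L) ^+ 2 * (P ^+ 2 + Q ^+ 2) + (alpha * r / 2) ^+ 2).
  have := sqr_ge0 (g * L * (P + Q) - alpha * r / 2).
  have := sqr_ge0 (g * L * (P - Q)).
  by nra.
by field; rewrite gt_eqF.
Qed.

(** The arithmetic of the induction step of [weighted_regret_sum], with primes for the new step.
    [K'] is the new cross term in the previous [r]; the weight condition turns it into the old [K],
    which the retained [q] absorbs. The increase of the weight costs nothing because [D - B] is
    nonnegative. *)
Lemma regret_step_arith {R : realType}
    (w w' B B' D K K' P P' q q' c c' e e' S S' X : R) :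
  0 <= w -> 0 <= w' -> w <= w' -> B <= D ->
  P' <= P + c * e' -> K <= q + c' * e -> w' * K' <= w * K ->
  X <= B - B' + (P' - P) + K' - q' ->
  w * (D - B) - w * q + c * S + c' * S' + w' * X <=
    w' * (D - B') - w' * q' + c * (S + w' * e') + c' * (S' + w * e).
Proof.
move=> w0 w'0 ww' BD /(ler_wpM2l w'0) h1 /(ler_wpM2l w0) h2 h3 /(ler_wpM2l w'0) h4.
have : 0 <= (w' - w) * (D - B) by rewrite mulr_ge0 ?subr_ge0.
lra.
Qed.

Lemma weighted_regret_sum {R : realType} (nu K alpha D C1 C2 : R)
    (gamma w e f p r B : nat -> R) (T : nat) :
  0 < nu -> 0 <= K -> 0 <= alpha -> 0 <= C2 ->
  (forall t, 0 <= w t) -> (forall t, w t <= w t.+1) ->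
  (forall t, w t.+1 * gamma t.+1 ^+ 2 <= w t * gamma t ^+ 2) ->
  (forall t, 0 <= e t) -> (forall t, 0 <= p t) -> (forall t, 0 <= r t) ->
  r 0%N = 0 ->
  (forall t, 0 <= B t <= D) ->
  (forall t s, 0 <= s ->
    K * gamma t ^+ 2 * s `^ nu <= alpha / 2 * s + C1 * e t) ->
  (forall t s, 0 <= s ->
    K * gamma t ^+ 2 * s `^ nu <= alpha / 4 * s + C2 * e t) ->
  (forall t, gamma t * f t <= B t - B t.+1
    + (K * gamma t ^+ 2 * p t `^ nu - alpha / 2 * p t)
    + K * gamma t ^+ 2 * r t `^ nu - alpha / 4 * r t.+1) ->
  \sum_(0 <= t < T.+1) w t * gamma t * f t <=
    w T * D + (C1 + C2) * \sum_(0 <= t < T.+1) w t * e t.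
Proof.
move=> nu0 K0 alpha0 C2_ge0 w0 w_nd wg_ni e0 p0 r_ge0 r0 B_bd young1 young2 step_le.
have BD t : B t <= D by have /andP[] := B_bd t.
have B0 t : 0 <= B t by have /andP[] := B_bd t.
pose S m := \sum_(0 <= t < m) w t * e t.
have S0 : S 0%N = 0 by rewrite /S big_geq.
have SS m : S m.+1 = S m + w m * e m by rewrite /S big_nat_recr.
rewrite -/(S T.+1); move: S S0 SS => S S0 SS.
(* The invariant keeps the slack [D - B] and the unspent negative [r] term. [C2] multiplies [S T],
   not [S T.+1], since the [r] term of a step is spent only at the next one. *)
suff H : \sum_(0 <= t < T.+1) w t * gamma t * f t <=
    w T * (D - B T.+1) - w T * (alpha / 4 * r T.+1) + C1 * S T.+1 + C2 * S T.
  apply: le_trans H _.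
  have h1 := mulr_ge0 (w0 T) (B0 T.+1).
  have h2 : 0 <= w T * (alpha / 4 * r T.+1) by rewrite mulr_ge0// mulr_ge0// divr_ge0.
  have h3 := mulr_ge0 C2_ge0 (mulr_ge0 (w0 T) (e0 T)).
  by rewrite SS; lra.
elim: T => [|T IH].
  rewrite big_nat1 SS S0 mulr0 addr0 add0r -mulrA.
  have h1 := young1 0%N _ (p0 0%N).
  (* No earlier step can absorb the first [r] term, but it vanishes as [r 0 = 0] and [nu] is
     nonzero. *)
  have := step_le 0%N; rewrite r0 powR0 ?gt_eqF// mulr0 addr0 => h2.
  apply: le_trans (ler_wpM2l (w0 0%N) h2) _.
  rewrite (mulrCA C1) -mulrBr -mulrDr ler_wpM2l//.
  by have := BD 0%N; lra.
rewrite big_nat_recr//=; apply: le_trans (lerD IH (lexx _)) _.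
rewrite !SS -(mulrA (w T.+1)).
apply: (regret_step_arith _ _ (w0 T) (w0 T.+1) (w_nd T) (BD T.+1)
  (young1 T.+1 _ (p0 T.+1)) (young2 T _ (r_ge0 T.+1)) _ (step_le T.+1)).
have E (v G : R) : v * (K * G * r T.+1 `^ nu) = v * G * (K * r T.+1 `^ nu) by ring.
by rewrite !E ler_wpM2r// mulr_ge0 ?powR_ge0.
Qed.

Section popov.
Context {R : realType} {n : nat} {N : 'rV[R]_n -> R} {X : set 'rV[R]_n}
  {F : 'rV[R]_n -> 'rV[R]_n} {psi : 'rV[R]_n -> R} {dpsi : 'rV[R]_n -> 'rV[R]_n}
  {alpha nu L D : R} (hN : is_norm N)
  (hXconvex : convex_set (X : set (convex_lmodType 'rV[R]_n)))
  (hpsi : C1_on X psi dpsi) (halpha : 0 < alpha)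
  (hpsiconvex : strongly_convex_on N X alpha psi dpsi)
  (hFmono : monotone_on X F) (nu01 : 0 < nu < 1) (hL : 0 < L)
  (hFholder : holder_on N X nu L F)
  (hBD : forall x z, X x -> X z -> bregman psi dpsi z x <= D).

Lemma bregman_ge0 x z : X x -> X z -> 0 <= bregman psi dpsi z x.
Proof.
move=> Xx Xz; have := hpsiconvex Xx Xz; rewrite /bregman.
have : 0 <= alpha / 2 * N (z - x) ^+ 2.
  by rewrite mulr_ge0 ?sqr_ge0// divr_ge0 ?(ltW halpha).
lra.
Qed.

(** The optimality of [x1] is tested at [z] and that of [y1] at [x1]. This splits the left side into
    Bregman terms and the error [g <F y1 - F y0, y1 - x1>]. Strong convexity between [y1, x1] and
    between [x0, y1] yields the negative squares, and the Hoelder bound with the triangle inequality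
    through [x0] controls the error. *)
Lemma popov_step (g : R) (x0 y0 y1 x1 z : 'rV[R]_n) : 0 <= g ->
  X x0 -> X y0 -> X z ->
  is_argmin X (fun u => inner (g *: F y0 - dpsi x0) u + psi u) y1 ->
  is_argmin X (fun u => inner (g *: F y1 - dpsi x0) u + psi u) x1 ->
  g * inner (F y1) (y1 - z) <=
    bregman psi dpsi z x0 - bregman psi dpsi z x1
    + (2 * L ^+ 2 / alpha * g ^+ 2 * (N (y1 - x0) ^+ 2) `^ nu
       - alpha / 2 * N (y1 - x0) ^+ 2)
    + 2 * L ^+ 2 / alpha * g ^+ 2 * (N (x0 - y0) ^+ 2) `^ nu
    - alpha / 4 * N (x1 - y1) ^+ 2.
Proof.
move=> g0 Xx0 Xy0 Xz y1min x1min.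
have Xy1 := y1min.1; have Xx1 := x1min.1.
have h1 := argmin_first_order hXconvex hpsi x1min Xz.
have h2 := argmin_first_order hXconvex hpsi y1min Xx1.
have h3 := hpsiconvex Xy1 Xx1.
have h4 := hpsiconvex Xx0 Xy1.
have h5 := dual_norm_cauchy_schwarz hN (y1 - x1) (hFholder Xy1 Xy0).
have m01 : 0 <= N (y1 - y0) <= N (y1 - x0) + N (x0 - y0).
  by rewrite is_norm_ge0//= -{1}(subrK x0 y1) -addrA is_norm_triangle.
have h6 := popov_cross_term_le nu01 halpha (ltW hL) g0 (is_norm_ge0 hN _)
  (is_norm_ge0 hN _) (is_norm_ge0 hN (y1 - x1)) m01.
have := le_trans (ler_wpM2l g0 h5) h6.
rewrite -(opprB x1 y1) (is_normN hN).
move: h1 h2 h3 h4; rewrite /bregman.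
rewrite !(innerDl, innerDr, innerNl, innerNr, innerZl).
set A := N (x1 - y1) ^+ 2; set B := N (y1 - x0) ^+ 2.
set C1 := _ * B `^ nu; set C2 := _ * (_ ^+ 2) `^ nu.
by lra.
Qed.

Lemma popov_weighted_regret (gamma w : nat -> R)
    (x y : nat -> 'rV[R]_n) (T : nat) (z : 'rV[R]_n) :
  (forall t, 0 <= gamma t) -> (forall t, 0 <= w t) ->
  (forall t, w t <= w t.+1) ->
  (forall t, w t.+1 * gamma t.+1 ^+ 2 <= w t * gamma t ^+ 2) ->
  popov_iterates X F psi dpsi gamma x y -> X z ->
  \sum_(0 <= t < T.+1) w t * gamma t * inner (F (y t.+1)) (y t.+1 - z) <=
    w T * D + Chat nu L alpha *
      \sum_(0 <= t < T.+1) w t * gamma t `^ (2 / (1 - nu)).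
Proof.
move=> gamma0 w0 w_nd wg_ni [Xx0 y0x0 xy] Xz.
have /andP[nu0 nu1] := nu01.
have Xx t : X (x t) by case: t => // t; exact: (xy t).2.1.
have Xy t : X (y t) by case: t => [|t]; [rewrite y0x0 | exact: (xy t).1.1].
(* The summands are swapped: the constant with [1 + nu] comes from absorption into [alpha / 2], the
   one with [1 + 2 * nu] from absorption into [alpha / 4]. *)
rewrite /Chat mulrDr [(1 - nu) * _ + _]addrC.
apply: (@weighted_regret_sum _ nu (2 * L ^+ 2 / alpha) alpha _ _ _ _ _ _ _
  (fun t => N (y t.+1 - x t) ^+ 2) (fun t => N (x t - y t) ^+ 2)
  (fun t => bregman psi dpsi z (x t))) => //.
- by rewrite divr_ge0 ?(ltW halpha)// mulr_ge0 ?sqr_ge0 ?ler0n.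
- exact: ltW.
- by rewrite mulr_ge0 ?powR_ge0// subr_ge0 ltW.
- by move=> t; exact: powR_ge0.
- by move=> t; exact: sqr_ge0.
- by move=> t; exact: sqr_ge0.
- by rewrite y0x0 subrr is_norm0// expr0n.
- by move=> t; rewrite bregman_ge0//= hBD.
- by move=> t s s0; have := holder_young L 1 nu01 halpha (gamma0 t) s0; rewrite mul1r.
- move=> t s s0; have := holder_young L 2 nu01 halpha (gamma0 t) s0.
  by rewrite (_ : 2 ^+ 2 = 4) //; ring.
- by move=> t; exact: popov_step (gamma0 t) (Xx t) (Xy t) Xz (xy t).1 (xy t).2.
Qed.

(** Monotonicity replaces [F (y t.+1)] by [F z] in the regret, which is then affine in the iterate
    and passes to the average. The regret bound does not depend on [z], so it bounds the supremum.
    The averaging weights [v] are the regret weights [w] times the step sizes. *)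
Lemma popov_dual_gap_le (v gamma w : nat -> R) (x y : nat -> 'rV[R]_n) (T : nat) :
  (forall t, 0 < gamma t) -> (forall t, 0 < w t) ->
  (forall t, w t <= w t.+1) ->
  (forall t, w t.+1 * gamma t.+1 ^+ 2 <= w t * gamma t ^+ 2) ->
  (forall t, v t = w t * gamma t) ->
  popov_iterates X F psi dpsi gamma x y ->
  (dual_gap X F ((\sum_(0 <= t < T.+1) v t)^-1 *:
      \sum_(0 <= t < T.+1) v t *: y t.+1) <=
    ((w T * D + Chat nu L alpha *
      \sum_(0 <= t < T.+1) w t * gamma t `^ (2 / (1 - nu)))
      / \sum_(0 <= t < T.+1) v t)%:E)%E.
Proof.
move=> gamma0 w0 w_nd wg_ni vE it.
have v0 t : 0 < v t by rewrite vE mulr_gt0.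
set V := \sum_(0 <= t < T.+1) v t.
have V0 : 0 < V.
  by rewrite /V big_nat_recr//= ltr_wpDl// sumr_ge0// => t _; exact: ltW.
apply: ge_ereal_sup => _ [z Xz <-]; rewrite lee_fin ler_pdivlMr// mulrC.
have -> : V * inner (F z) (V^-1 *: (\sum_(0 <= t < T.+1) v t *: y t.+1) - z) =
    \sum_(0 <= t < T.+1) v t * inner (F z) (y t.+1 - z).
  rewrite innerDr innerNr innerZr inner_sumr mulrBr mulrA divff ?gt_eqF// mul1r.
  rewrite /V mulr_suml -sumrB; apply: eq_bigr => t _.
  by rewrite innerZr innerDr innerNr mulrBr.
apply: le_trans (popov_weighted_regret T (fun t => ltW (gamma0 t))
  (fun t => ltW (w0 t)) w_nd wg_ni it Xz).
apply: ler_sum => t _; rewrite vE ler_wpM2l ?mulr_ge0 ?(ltW (w0 _)) ?(ltW (gamma0 _))//.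
have Xy : X (y t.+1) by case: it => _ _ /(_ t)[[]].
by have := hFmono Xy Xz; rewrite innerDl innerNl subr_ge0.
Qed.

End popov.

(** * Step sizes *)

Lemma step_powR {R : realType} (c a e x : R) : 0 < c ->
  (c / x `^ a) `^ e = c `^ e * x `^ (- (a * e)).
Proof.
move=> c0; rewrite powRM ?(ltW c0) ?invr_ge0 ?powR_ge0//.
by rewrite powRV ?powR_ge0// -powRrM powRN.
Qed.

Lemma step_gt0 {R : realType} (c a : R) (t : nat) : 0 < c -> 0 < step c a t.
Proof. by move=> c0; rewrite divr_gt0 ?powR_gt0 ?ltr0n. Qed.

Lemma step_nincr {R : realType} (c a : R) (s t : nat) : 0 < c -> 0 <= a ->
  (s <= t)%N -> step c a t <= step c a s.
Proof.
move=> c0 a0 st; rewrite ler_wpM2l ?(ltW c0)// lef_pV2 ?posrE ?powR_gt0 ?ltr0n//.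
by rewrite ge0_ler_powR// ?nnegrE// ler_nat.
Qed.

Lemma sum_step_ge {R : realType} (c a : R) (T : nat) : 0 < c -> 0 <= a ->
  c * T.+1%:R `^ (1 - a) <= \sum_(0 <= t < T.+1) step c a t.
Proof.
move=> c0 a0; have T0 : 0 < T.+1%:R :> R by rewrite ltr0n.
rewrite powRD_gt0// powRr1 ?(ltW T0)// powRN.
have -> : c * (T.+1%:R / T.+1%:R `^ a) = \sum_(0 <= t < T.+1) step c a T.
  by rewrite sumr_const_nat subn0 -[RHS]mulr_natl /step [RHS]mulrCA.
by apply: ler_sum_nat => t /andP[_ tT]; exact: step_nincr.
Qed.

Lemma sum_stepV_ge {R : realType} (c a : R) (T : nat) : 0 < c -> 0 < a ->
  T.+1%:R `^ (1 + a) / (c * (1 + a)) <= \sum_(0 <= t < T.+1) (step c a t)^-1.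
Proof.
move=> c0 a0; have := sum_powR_ge T.+1 a0.
rewrite -(ler_pM2l (x := c^-1)) ?invr_gt0//.
rewrite mulrC -mulrA -invfM (mulrC _ c) => /le_trans; apply.
by rewrite mulr_sumr ler_sum// => t _; rewrite /step invf_div mulrC.
Qed.

Lemma sum_step_powR {R : realType} (c a e : R) (m : nat) : 0 < c ->
  \sum_(0 <= t < m) step c a t `^ e =
    c `^ e * \sum_(0 <= t < m) t.+1%:R `^ (- (a * e)).
Proof. by move=> c0; rewrite mulr_sumr; apply: eq_bigr => t _; rewrite step_powR. Qed.

Lemma Chat_ge0 {R : realType} (nu L alpha : R) : nu <= 1 -> 0 <= Chat nu L alpha.
Proof. by move=> nu1; rewrite mulr_ge0 ?subr_ge0// addr_ge0 ?powR_ge0. Qed.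

(** Since [1 + 2 * nu = nu + (1 + nu)], the first summand of [Chat] is [2 ^ (nu / (1 - nu))] times
    the second. This is the shape of the constant in (iii). *)
Lemma ChatE {R : realType} (nu L alpha : R) : 0 < alpha ->
  Chat nu L alpha =
    (1 - nu) * (2 `^ (nu / (1 - nu)) + 1) * holder_const nu L alpha (1 + nu).
Proof.
move=> alpha0; rewrite /Chat -mulrA [(_ `^ _ + 1) * _]mulrDl mul1r; congr (_ * (_ + _)).
rewrite /holder_const (_ : 2 `^ (nu / (1 - nu)) = (2 `^ nu) `^ (1 / (1 - nu))).
  2: by rewrite div1r powRrM.
rewrite -powRM ?powR_ge0//; last first.
  by rewrite divr_ge0 ?powR_ge0// mulr_ge0 ?powR_ge0// mulr_ge0 ?powR_ge0 ?sqr_ge0.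
congr (_ `^ _).
rewrite (_ : 1 + 2 * nu = nu + (1 + nu)); last by ring.
by rewrite [2 `^ (_ + _)]powRD_gt0// !mulrA.
Qed.

(** * Gap bounds for the three choices of weights *)

Section rates.
Context {R : realType} {n : nat} {N : 'rV[R]_n -> R} {X : set 'rV[R]_n}
  {F : 'rV[R]_n -> 'rV[R]_n} {psi : 'rV[R]_n -> R} {dpsi : 'rV[R]_n -> 'rV[R]_n}
  {alpha nu L D : R} (hN : is_norm N)
  (hXconvex : convex_set (X : set (convex_lmodType 'rV[R]_n)))
  (hpsi : C1_on X psi dpsi) (halpha : 0 < alpha)
  (hpsiconvex : strongly_convex_on N X alpha psi dpsi)
  (hFmono : monotone_on X F) (nu01 : 0 < nu < 1) (hL : 0 < L)
  (hFholder : holder_on N X nu L F) (hD : 0 < D)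
  (hBD : forall x z, X x -> X z -> bregman psi dpsi z x <= D).

Let gap_le := popov_dual_gap_le hN hXconvex hpsi halpha hpsiconvex hFmono nu01
  hL hFholder hBD.

(** Regret weights [1 / g] make the averaging weights equal to [1]; the error per step is then
    [g ^ (2 / (1 - nu) - 1)]. *)
Lemma popov_gap_const (g : R) (T : nat) (x y : nat -> 'rV[R]_n) : 0 < g ->
  popov_iterates X F psi dpsi (fun=> g) x y ->
  (dual_gap X F (T.+1%:R^-1 *: \sum_(0 <= t < T.+1) y t.+1) <=
    (D / (g * T.+1%:R) + Chat nu L alpha * g `^ ((1 + nu) / (1 - nu)))%:E)%E.
Proof.
move=> g0 it; have nu1 : 1 - nu != 0 by rewrite gt_eqF// subr_gt0; case/andP: nu01.
have := @gap_le (fun=> 1) (fun=> g) (fun=> g^-1) x y T (fun=> g0).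
rewrite invr_gt0 mulVf ?gt_eqF// !sumr_const_nat subn0.
rewrite (eq_bigr (fun t => y t.+1)); last by move=> t _; rewrite scale1r.
move=> /(_ (fun=> g0) (fun=> lexx _) (fun=> lexx _) (fun=> erefl) it) /le_trans.
apply; rewrite lee_fin -[_ *+ _]mulr_natl.
have -> : g `^ ((1 + nu) / (1 - nu)) = g^-1 * g `^ (2 / (1 - nu)).
  rewrite -[g^-1](powR_inv1 (ltW g0)) -powRD_gt0//; congr (_ `^ _).
  by field.
have T0 : T.+1%:R != 0 :> R by rewrite pnatr_eq0.
move: (Chat _ _ _) (g `^ _) (T.+1%:R : R) T0 => C G M M0.
by rewrite le_eqVlt; apply/orP; left; apply/eqP; field; rewrite M0 gt_eqF.
Qed.

Context (c a : R) (hc : 0 < c) (ha0 : 0 < a).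

(** Regret weights [1]. The bound [S] on the power sum is left open, so that each regime of [a] can
    supply its own. *)
Lemma popov_gap_step (S : R) (T : nat) (x y : nat -> 'rV[R]_n) :
  popov_iterates X F psi dpsi (step c a) x y ->
  \sum_(0 <= t < T.+1) t.+1%:R `^ (- (2 * a / (1 - nu))) <= S ->
  (dual_gap X F ((\sum_(0 <= t < T.+1) step c a t)^-1 *:
      \sum_(0 <= t < T.+1) step c a t *: y t.+1) <=
    (D / (c * T.+1%:R `^ (1 - a))
     + Chat nu L alpha * c `^ ((1 + nu) / (1 - nu)) * S / T.+1%:R `^ (1 - a))%:E)%E.
Proof.
move=> it hS; have /andP[nu0 nu1] := nu01.
have nuN : 1 - nu != 0 by rewrite gt_eqF// subr_gt0.
have step0 t := step_gt0 a t hc.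
have := @gap_le (step c a) (step c a) (fun=> 1) x y T step0 (fun=> ltr01)
  (fun=> lexx _) _ _ it.
move=> /(_ _ _)/le_trans; apply.
  move=> t; rewrite !mul1r ler_sqr ?nnegrE ?(ltW (step0 _))//.
  by rewrite step_nincr// ltW.
- by move=> t; rewrite mul1r.
rewrite lee_fin mul1r; under eq_bigr do rewrite mul1r.
rewrite sum_step_powR// (_ : a * _ = 2 * a / (1 - nu)); last by ring.
have M0 : 0 < T.+1%:R `^ (1 - a) :> R by rewrite powR_gt0 ?ltr0n.
have sumge := sum_step_ge T hc (ltW ha0).
have cM0 := mulr_gt0 hc M0.
have C0 := Chat_ge0 L alpha (ltW nu1).
set s := \sum_(0 <= t < T.+1) _ `^ _ in hS *.
apply: (@le_trans _ _ ((D + Chat nu L alpha * (c `^ (2 / (1 - nu)) * S))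
    / (c * T.+1%:R `^ (1 - a)))).
  apply: ler_pM; rewrite ?invr_ge0.
  - rewrite addr_ge0 ?(ltW hD)// mulr_ge0// mulr_ge0 ?powR_ge0//.
    by rewrite sumr_ge0// => t _; exact: powR_ge0.
  - by rewrite (le_trans _ sumge)// ltW.
  - by rewrite lerD2l ler_wpM2l// ler_wpM2l ?powR_ge0.
  - by rewrite lef_pV2 ?posrE// (lt_le_trans _ sumge).
have -> : c `^ (2 / (1 - nu)) = c * c `^ ((1 + nu) / (1 - nu)).
  rewrite -{2}[c](powRr1 (ltW hc)) -powRD_gt0//; congr (_ `^ _).
  by field.
move: (Chat _ _ _) (c `^ _) (T.+1%:R `^ _) M0 => C G M M0.
by rewrite le_eqVlt; apply/orP; left; apply/eqP; field; rewrite !gt_eqF.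
Qed.

(** Regret weights [gamma ^ (-2)], for which [w * gamma ^ 2] is constantly [1]. They lower the
    exponent of the error terms from [2 / (1 - nu)] to [2 * nu / (1 - nu)], which moves the critical
    value of [a]. *)
Lemma popov_gap_stepV (S : R) (T : nat) (x y : nat -> 'rV[R]_n) :
  popov_iterates X F psi dpsi (step c a) x y ->
  \sum_(0 <= t < T.+1) t.+1%:R `^ (- (2 * nu * a / (1 - nu))) <= S ->
  (dual_gap X F ((\sum_(0 <= t < T.+1) (step c a t)^-1)^-1 *:
      \sum_(0 <= t < T.+1) (step c a t)^-1 *: y t.+1) <=
    ((1 + a) * D / (c * T.+1%:R `^ (1 - a))
     + (1 + a) * Chat nu L alpha * c `^ ((1 + nu) / (1 - nu)) * S
       / T.+1%:R `^ (1 + a))%:E)%E.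
Proof.
move=> it hS; have /andP[nu0 nu1] := nu01.
have nuN : 1 - nu != 0 by rewrite gt_eqF// subr_gt0.
have a10 : 0 < 1 + a by rewrite addr_gt0.
have T0 : 0 < T.+1%:R :> R by rewrite ltr0n.
have step0 t := step_gt0 a t hc.
have step2V t : (step c a t) ^- 2 * step c a t ^+ 2 = 1.
  by rewrite mulVf// expf_neq0// gt_eqF.
have := @gap_le (fun t => (step c a t)^-1) (step c a)
  (fun t => (step c a t) ^- 2) x y T step0 _ _ _ _ it.
move=> /(_ _ _ _ _)/le_trans; apply.
- by move=> t; rewrite invr_gt0 exprn_gt0.
- move=> t; rewrite lef_pV2 ?posrE ?exprn_gt0// ler_sqr ?nnegrE ?(ltW (step0 _))//.
  by rewrite step_nincr// ltW.
- by move=> t; rewrite !step2V.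
- by move=> t; rewrite -exprVn expr2 -mulrA mulVf ?mulr1 ?gt_eqF.
have E t : (step c a t) ^- 2 * step c a t `^ (2 / (1 - nu)) =
    step c a t `^ (2 * nu / (1 - nu)).
  rewrite -powR_invn ?(ltW (step0 _))// -powRD_gt0//; congr (_ `^ _).
  by field.
rewrite lee_fin; under eq_bigr do rewrite E.
rewrite sum_step_powR// (_ : a * _ = 2 * nu * a / (1 - nu)); last by ring.
have M0 : 0 < T.+1%:R `^ (1 + a) :> R by rewrite powR_gt0.
have sumge := sum_stepV_ge T hc ha0.
have cM0 := divr_gt0 M0 (mulr_gt0 hc a10).
have C0 := Chat_ge0 L alpha (ltW nu1).
set s := \sum_(0 <= t < T.+1) _ `^ _ in hS *.
have s0 : 0 <= s by apply: sumr_ge0 => t _; exact: powR_ge0.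
apply: (@le_trans _ _ (((step c a T) ^- 2 * D
    + Chat nu L alpha * (c `^ (2 * nu / (1 - nu)) * S))
    / (T.+1%:R `^ (1 + a) / (c * (1 + a))))).
  apply: ler_pM; rewrite ?invr_ge0.
  - by rewrite addr_ge0// mulr_ge0 ?(ltW hD)// ?invr_ge0 ?exprn_ge0 ?(ltW (step0 _))//
      mulr_ge0 ?powR_ge0.
  - by rewrite (le_trans _ sumge)// ltW.
  - by rewrite lerD2l ler_wpM2l// ler_wpM2l ?powR_ge0.
  - by rewrite lef_pV2 ?posrE// (lt_le_trans _ sumge).
have -> : c `^ ((1 + nu) / (1 - nu)) = c * c `^ (2 * nu / (1 - nu)).
  rewrite -{2}[c](powRr1 (ltW hc)) -powRD_gt0//; congr (_ `^ _).
  by field.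
rewrite /step powRD_gt0// [T.+1%:R `^ (1 - a)]powRD_gt0// powRr1 ?(ltW T0)// powRN.
have := powR_gt0 a T0.
move: (Chat _ _ _) (c `^ _) (T.+1%:R : R) T0 (_ `^ a) => C G M M_gt0 A A0.
by rewrite le_eqVlt; apply/orP; left; apply/eqP; field; rewrite !gt_eqF.
Qed.

End rates.

(** * Assembly of the three statements *)

Lemma powR_div_merge {R : realType} (x k p q r : R) : 0 < x ->
  k * (x `^ p / q) / x `^ r = k / (q * x `^ (r - p)).
Proof.
move=> x0; rewrite invfM -!powRN opprB powRD_gt0// powRN; ring.
Qed.

Unset Implicit Arguments.

Theorem theorem9 (R : realType) (n : nat) (N : 'rV[R]_n -> R)
    (X : set 'rV[R]_n) (F : 'rV[R]_n -> 'rV[R]_n)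
    (psi : 'rV[R]_n -> R) (dpsi : 'rV[R]_n -> 'rV[R]_n)
    (alpha nu L D c a : R)
    (hN : is_norm N)
    (hX0 : X !=set0) (hXclosed : closed X)
    (hXconvex : convex_set (X : set (convex_lmodType 'rV[R]_n)))
    (hXbounded : bounded_set X)
    (hpsi : C1_on X psi dpsi)
    (halpha : 0 < alpha)
    (hpsiconvex : strongly_convex_on N X alpha psi dpsi)
    (hFmono : monotone_on X F)
    (hnu0 : 0 < nu) (hnu1 : nu < 1) (hL : 0 < L)
    (hFholder : holder_on N X nu L F)
    (hD : 0 < D)
    (hBD : forall x z, X x -> X z -> bregman psi dpsi z x <= D)
    (hc : 0 < c) (ha0 : 0 < a) (ha1 : a < 1) :
  (* (i) *)
  (forall (T : nat) (x y : nat -> 'rV[R]_n),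
    popov_iterates X F psi dpsi (fun _ : nat => c / T.+1%:R `^ a) x y ->
    (dual_gap X F (T.+1%:R^-1 *: \sum_(0 <= t < T.+1) y t.+1) <=
     (D / (c * T.+1%:R `^ (1 - a))
      + Chat nu L alpha * c `^ ((1 + nu) / (1 - nu))
        / T.+1%:R `^ (a * (1 + nu) / (1 - nu)))%:E)%E)
  /\
  (* (ii) *)
  (forall (T : nat) (x y : nat -> 'rV[R]_n),
    popov_iterates X F psi dpsi (step c a) x y ->
    let G := dual_gap X F
      ((\sum_(0 <= t < T.+1) step c a t)^-1 *:
         \sum_(0 <= t < T.+1) step c a t *: y t.+1) in
    [/\ a < (1 - nu) / 2 ->
        (G <= (D / (c * T.+1%:R `^ (1 - a))
               + Chat nu L alpha * (1 - nu) * c `^ ((1 + nu) / (1 - nu))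
                 / ((1 - nu - 2 * a)
                    * T.+1%:R `^ (a * (1 + nu) / (1 - nu))))%:E)%E,
        a = (1 - nu) / 2 ->
        (G <= (D / (c * T.+1%:R `^ (1 - a))
               + Chat nu L alpha * c `^ ((1 + nu) / (1 - nu))
                 * (1 + ln T.+1%:R) / T.+1%:R `^ (1 - a))%:E)%E &
        (1 - nu) / 2 < a ->
        (G <= (D / (c * T.+1%:R `^ (1 - a))
               + 2 * a * Chat nu L alpha * c `^ ((1 + nu) / (1 - nu))
                 / ((2 * a + nu - 1) * T.+1%:R `^ (1 - a)))%:E)%E])
  /\
  (* (iii) *)
  (forall (T : nat) (x y : nat -> 'rV[R]_n),
    (1 <= T)%N ->
    popov_iterates X F psi dpsi (step c a) x y ->
    let G := dual_gap X F
      ((\sum_(0 <= t < T.+1) (step c a t)^-1)^-1 *: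
         \sum_(0 <= t < T.+1) (step c a t)^-1 *: y t.+1) in
    [/\ a < (1 - nu) / (2 * nu) ->
        (G <= (4 `^ a * (1 + a) * D / (c * T%:R `^ (1 - a))
               + 2 `^ ((1 - nu - 2 * nu * a) / (1 - nu))
                 * c `^ ((1 + nu) / (1 - nu)) * (1 + a) * (1 - nu) ^+ 2
                 * (2 `^ (nu / (1 - nu)) + 1)
                 * holder_const nu L alpha (1 + nu)
                 / ((1 - nu - 2 * nu * a)
                    * T%:R `^ (a * (1 + nu) / (1 - nu))))%:E)%E,
        a = (1 - nu) / (2 * nu) ->
        (G <= (4 `^ a * (1 + a) * D / (c * T%:R `^ (1 - a))
               + c `^ ((1 + nu) / (1 - nu)) * (1 + a) * (1 - nu)
                 * (2 `^ (nu / (1 - nu)) + 1)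
                 * holder_const nu L alpha (1 + nu)
                 * (1 + ln T.+1%:R) / T%:R `^ (1 + a))%:E)%E &
        (1 - nu) / (2 * nu) < a ->
        (G <= (4 `^ a * (1 + a) * D / (c * T%:R `^ (1 - a))
               + 2 * a * nu * c `^ ((1 + nu) / (1 - nu)) * (1 + a) * (1 - nu)
                 * (2 `^ (nu / (1 - nu)) + 1)
                 * holder_const nu L alpha (1 + nu)
                 / ((2 * nu * a + nu - 1) * T%:R `^ (1 + a)))%:E)%E]).
Proof.
have nu01 : 0 < nu < 1 by rewrite hnu0.
have nu'0 : 0 < 1 - nu by rewrite subr_gt0.
have nuN : 1 - nu != 0 by rewrite gt_eqF.
have C0 := Chat_ge0 L alpha (ltW hnu1).
split; [|split].
- move=> T x y it.
  have T0 : 0 < T.+1%:R :> R by rewrite ltr0n.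
  have := popov_gap_const hN hXconvex hpsi halpha hpsiconvex hFmono nu01
    hL hFholder hBD T (divr_gt0 hc (powR_gt0 a T0)) it.
  rewrite step_powR// powRN mulrA [a * _]mulrA.
  rewrite (_ : c / _ * T.+1%:R = c * T.+1%:R `^ (1 - a))//.
  by rewrite powRD_gt0// powRr1 ?(ltW T0)// powRN mulrAC mulrA.
- move=> T x y it G.
  have T0 : 0 < T.+1%:R :> R by rewrite ltr0n.
  have gap S := popov_gap_step hN hXconvex hpsi halpha hpsiconvex hFmono nu01
    hL hFholder hD hBD hc ha0 (S := S) (T := T) it.
  (* The three regimes of [a] are [b < 1], [b = 1] and [b > 1] for this exponent of the power
     sum. *)
  set b := 2 * a / (1 - nu) in gap.
  split=> ha.
  + have b01 : 0 < b < 1.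
      by rewrite divr_gt0 ?mulr_gt0//= ltr_pdivrMr// mul1r; lra.
    apply: le_trans (gap _ (sum_powRN_le_lt1 T.+1 b01)) _.
    rewrite lee_fin lerD2l powR_div_merge//.
    rewrite (_ : 1 - a - (1 - b) = a * (1 + nu) / (1 - nu)); last first.
      by rewrite /b; field.
    rewrite (_ : 1 - b = (1 - nu - 2 * a) / (1 - nu)); last first.
      by rewrite /b; field.
    move: (Chat _ _ _) (c `^ _) (T.+1%:R `^ _) => C cp A.
    by rewrite le_eqVlt !invfM ?invrK; apply/orP; left; apply/eqP; ring.
  + have b1 : b = 1 by rewrite /b ha; field.
    apply: gap; rewrite b1; apply: le_trans (sum_inv_le T).
    by apply: ler_sum => t _; rewrite powR_inv1.
  + have b1 : 1 < b by rewrite ltr_pdivlMr// mul1r; lra.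
    apply: le_trans (gap _ (sum_powRN_le_gt1 T.+1 b1)) _.
    rewrite lee_fin lerD2l.
    rewrite (_ : b / (b - 1) = 2 * a / (2 * a + nu - 1)); last first.
      rewrite /b; field; rewrite nuN /= gt_eqF; lra.
    move: (Chat _ _ _) (c `^ _) (T.+1%:R `^ _) => C cp A.
    by rewrite le_eqVlt !invfM ?invrK; apply/orP; left; apply/eqP; ring.
- move=> [//|T'] x y _ it G; set T := T'.+1 in it *.
  have T0 : 0 < T%:R :> R by rewrite ltr0n.
  have T1 : 0 < T.+1%:R :> R by rewrite ltr0n.
  have a10 : 0 < 1 + a by rewrite addr_gt0.
  (* The gap bounds come with powers of [T + 1], while (iii) is stated with powers of [T], positive
     because [T >= 1]. *)
  have powT e : 0 <= e -> (T.+1%:R `^ e)^-1 <= (T%:R `^ e)^-1 :> R.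
    move=> e0; rewrite lef_pV2 ?posrE ?powR_gt0//.
    by rewrite ge0_ler_powR ?nnegrE// ler_nat.
  have gap S := popov_gap_stepV hN hXconvex hpsi halpha hpsiconvex hFmono nu01
    hL hFholder hD hBD hc ha0 (S := S) (T := T) it.
  set b := 2 * nu * a / (1 - nu) in gap.
  have bias : (1 + a) * D / (c * T.+1%:R `^ (1 - a)) <=
      4 `^ a * (1 + a) * D / (c * T%:R `^ (1 - a)).
    rewrite !invfM; apply: ler_pM.
    * by rewrite mulr_ge0 ?ltW.
    * by rewrite mulr_ge0 ?invr_ge0 ?powR_ge0 ?(ltW hc).
    * rewrite -[leRHS]mulrA ler_peMl ?mulr_ge0 ?(ltW a10) ?(ltW hD)//.
      by rewrite -[leLHS](powRr0 4) ler_powR ?(ltW ha0)// ler1n.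
    * by rewrite ler_wpM2l ?invr_ge0 ?(ltW hc)// powT// subr_ge0 ltW.
  have K0 : 0 <= (1 + a) * Chat nu L alpha * c `^ ((1 + nu) / (1 - nu)).
    by rewrite mulr_ge0 ?powR_ge0// mulr_ge0 ?(ltW a10).
  have KE := ChatE nu L halpha.
  split=> ha.
  + have b01 : 0 < b < 1.
      rewrite divr_gt0 ?mulr_gt0//= ltr_pdivrMr// mul1r.
      by move: ha; rewrite ltr_pdivlMr ?mulr_gt0//; lra.
    apply: le_trans (gap _ (sum_powRN_le_lt1 T.+1 b01)) _.
    rewrite lee_fin lerD// powR_div_merge//.
    rewrite (_ : 1 + a - (1 - b) = a * (1 + nu) / (1 - nu)); last first.
      by rewrite /b; field.
    rewrite (_ : 1 - b = (1 - nu - 2 * nu * a) / (1 - nu)); last first.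
      by rewrite /b; field.
    have u0 : 0 < 1 - nu - 2 * nu * a.
      by move: ha; rewrite ltr_pdivlMr ?mulr_gt0//; lra.
    rewrite invfM invf_div mulrA.
    apply: le_trans (ler_wpM2l _ (powT _ _)) _.
    * by rewrite mulr_ge0// divr_ge0 ?ltW.
    * by rewrite divr_ge0 ?(ltW nu'0)// mulr_ge0 ?addr_ge0 ?(ltW ha0) ?(ltW hnu0).
    (* The power of [2] has a positive exponent in this regime, hence is at least [1], and the bound
       without it suffices. *)
    rewrite [leRHS](_ : _ = 2 `^ ((1 - nu - 2 * nu * a) / (1 - nu)) *
      ((1 + a) * Chat nu L alpha * c `^ ((1 + nu) / (1 - nu)) *
       ((1 - nu) / (1 - nu - 2 * nu * a)) / T%:R `^ (a * (1 + nu) / (1 - nu)))).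
      rewrite ler_peMl//.
        by rewrite mulr_ge0 ?invr_ge0 ?powR_ge0// mulr_ge0// divr_ge0 ?ltW.
      by rewrite -[leLHS](powRr0 2) ler_powR ?divr_ge0 ?(ltW u0) ?(ltW nu'0)// ler1n.
    rewrite KE invfM; move: (_ `^ _) (_ `^ _) (holder_const _ _ _ _) (_ `^ _) (_ `^ _).
    by move=> *; ring.
  + have b1 : b = 1 by rewrite /b ha; field; rewrite nuN gt_eqF.
    apply: le_trans (gap (1 + ln T.+1%:R) _) _.
      rewrite b1; apply: le_trans (sum_inv_le T).
      by apply: ler_sum => t _; rewrite powR_inv1.
    rewrite lee_fin lerD//.
    have l0 : 0 <= 1 + ln T.+1%:R :> R by rewrite addr_ge0// ln_ge0// ler1n.
    apply: le_trans (ler_wpM2l _ (powT _ (ltW a10))) _; first by rewrite mulr_ge0.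
    rewrite le_eqVlt KE; apply/orP; left; apply/eqP.
    move: (_ `^ _) (_ `^ _) (holder_const _ _ _ _) (_ `^ _) (ln _).
    by move=> *; ring.
  + have b1 : 1 < b.
      rewrite ltr_pdivlMr// mul1r.
      by move: ha; rewrite ltr_pdivrMr ?mulr_gt0//; lra.
    have u0 : 0 < 2 * nu * a + nu - 1.
      by move: ha; rewrite ltr_pdivrMr ?mulr_gt0//; lra.
    apply: le_trans (gap _ (sum_powRN_le_gt1 T.+1 b1)) _.
    rewrite lee_fin lerD//.
    rewrite (_ : b / (b - 1) = 2 * nu * a / (2 * nu * a + nu - 1)); last first.
      rewrite /b; field; rewrite nuN /= gt_eqF; lra.
    apply: le_trans (ler_wpM2l _ (powT _ (ltW a10))) _.
      by rewrite mulr_ge0// divr_ge0 ?mulr_ge0 ?ltW.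
    rewrite le_eqVlt KE invfM; apply/orP; left; apply/eqP.
    move: (_ `^ _) (_ `^ _) (holder_const _ _ _ _) (_ `^ _).
    by move=> *; ring.
Qed.
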